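(* Fix integers $n\geq 8$, $f\geq 0$, $d\geq 2$ and $k\geq 1$. Then there exists a finite simple non-complete connected graph $G$ on the vertex set $[n]=\{1,\ldots,n\}$ with $f(G)+\operatorname{diam}(G)+\kappa(G)=n+1$ and $(f(G),\operatorname{diam}(G),\kappa(G))=(f,d,k)$ if and only if $f+d+k=n+1$ and one of the following conditions is satisfied: (1) $f\geq 2$, $k\geq 1$ and $d=2$; (2) $f\geq 2$, $k=1$ and $d\geq 2$; (3) $f\geq 2$, $k=2$ and $d=3$.
   Context: For a finite simple connected graph $G$ on $[n]$: the distance of two distinct vertices is the smallest length (number of edges) of a path in $G$ connecting them, and $\operatorname{diam}(G)$ is the maximum of all such distances. $\kappa(G)$ denotes the vertex connectivity: for non-complete $G$, the smallest cardinality of a subset $T\subset[n]$ such that the induced subgraph of $G$ on $[n]\setminus T$ is disconnected. A vertex $i$ is free (simplicial) if whenever $\{i,j\},\{i,j'\}\in E(G)$ with $j\neq j'$, then $\{j,j'\}\in E(G)$. $f(G)$ denotes the number of free vertices of $G$. *)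

(* Defs.v *)
From mathcomp Require Import all_boot.

Set Implicit Arguments.
Unset Strict Implicit.
Unset Printing Implicit Defensive.

Section Graph.
Variables (T : finType) (G : rel T).

Definition simple_graph : Prop := symmetric G /\ irreflexive G.

Definition complete_graph : bool := [forall x, forall y, (x != y) ==> G x y].

Definition induced (A : {set T}) : rel T :=
  [rel x y | [&& x \in A, y \in A & G x y]].

Definition connected_in (A : {set T}) : bool :=
  [forall x in A, forall y in A, connect (induced A) x y].

Definition connected_graph : bool := connected_in [set: T].

Definition is_path (x y : T) (p : seq T) : bool :=
  [&& path G x p, last x p == y & uniq (x :: p)].

Definition has_path (x y : T) (l : nat) : bool :=
  [exists p : l.-tuple T, is_path x y p].

(* A path has fewer than #|T| edges, so the default #|T| is returned exactly
   when x and y are not joined by a path. *)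
Definition distance (x y : T) : nat :=
  \big[minn/#|T|]_(l < #|T| | has_path x y l) l.

Definition diam : nat := \max_(x : T) \max_(y : T | x != y) distance x y.

Definition separating (S : {set T}) : bool := ~~ connected_in (~: S).

(* A separating set misses at least two vertices, so the default #|T|.-1 (the
   usual connectivity of a complete graph) is never reached when G is a
   non-complete simple graph. *)
Definition kappa : nat :=
  \big[minn/#|T|.-1]_(S : {set T} | separating S) #|S|.

Definition free_vertex (i : T) : bool :=
  [forall j, forall j', [&& G i j, G i j' & j != j'] ==> G j j'].

Definition num_free : nat := #|[set i | free_vertex i]|.

End Graph.

(* Main.v *)
(** Let [x] and [y] realise the diameter [d >= 2]. For [0 < i < d] the non-free
    vertices at distance [i] from [x] separate [x] from [y], since the interior
    vertices of a chordless path are not free. So there are at least [k (d - 1)]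
    non-free vertices besides [x] and [y]. As there are [d + k - 1] non-free
    vertices in all, [(k - 1) (d - 2) <= 1], i.e. [k = 1], [d = 2] or
    [(k, d) = (2, 3)]. If at most one vertex were free, all vertices other than
    [x] and [y] would be counted and non-free, and then [x] and [y] would both be
    free. Conversely, each admissible triple is realised by an explicit graph in
    which the non-free vertices form an initial segment of ['I_n]. *)

Require Import Defs.
From mathcomp Require Import all_boot.
From mathcomp Require Import zify.

Set Implicit Arguments.
Unset Strict Implicit.
Unset Printing Implicit Defensive.

(** * Minima over a finite type with a default value *)

Lemma bigminn_leq (I : finType) (P : pred I) (F : I -> nat) m i :
  P i -> \big[minn/m]_(j | P j) F j <= F i.
Proof.
rewrite -big_filter => Pi.
have : i \in [seq j <- index_enum I | P j] by rewrite mem_filter Pi mem_index_enum.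
elim: filter => // j s IHs; rewrite inE big_cons geq_min.
by case/predU1P=> [->|/IHs ->]; rewrite ?leqnn ?orbT.
Qed.

Lemma leq_bigminn (I : finType) (P : pred I) (F : I -> nat) m a :
  a <= m -> (forall i, P i -> a <= F i) -> a <= \big[minn/m]_(j | P j) F j.
Proof.
move=> am aF; elim/big_ind: _ => // x y ax ay.
by rewrite leq_min ax.
Qed.

Lemma bigminn_attained (I : finType) (P : pred I) (F : I -> nat) m :
  let b := \big[minn/m]_(j | P j) F j in
  b = m \/ exists2 i, P i & b = F i.
Proof.
elim/big_ind: _ => [|x y hx hy|i Pi]; [by left | | by right; exists i].
by case: (leqP x y).
Qed.

(** * Distances, diameter, connectivity and free vertices of a graph *)

Section Graph.
Variables (T : finType) (G : rel T).

Lemma uniq_size_lt (x : T) q : uniq (x :: q) -> size q < #|T|.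
Proof. by move/card_uniqP=> /= <-; apply: max_card. Qed.

(** [distance] is a minimum over simple paths only, but a walk shortens to a simple path through a
    subset of its vertices, hence a path that is no longer. *)
Lemma distance_le_path x p : path G x p -> distance G x (last x p) <= size p.
Proof.
case/shortenP=> q Gq Uq sub_qp.
apply: (leq_trans (n := size q)); last first.
  by apply: uniq_leq_size sub_qp; case/andP: Uq.
have lt_q := uniq_size_lt Uq.
suff Pq : has_path G x (last x q) (Ordinal lt_q).
  exact: (bigminn_leq (P := fun l : 'I_#|T| => has_path G x (last x q) l)
            (fun l : 'I_#|T| => l : nat) _ Pq).
apply/existsP; exists (in_tuple q).
by rewrite /is_path Gq Uq /= eqxx.
Qed.

Lemma connected_graphP x y : connected_graph G -> connect G x y.
Proof.
move/forall_inP/(_ x (in_setT x))/forall_inP/(_ y (in_setT y)).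
by apply: connect_sub => u v /= /and3P[_ _ /connect1].
Qed.

Lemma distance_path x y : connect G x y ->
  exists p, [/\ path G x p, last x p = y & size p = distance G x y].
Proof.
case/connectP=> p Gp ->.
case/shortenP: Gp => q Gq Uq _ {p}.
have le_q := distance_le_path Gq.
have := bigminn_attained (fun l : 'I_#|T| => has_path G x (last x q) l)
  (fun l : 'I_#|T| => l : nat) #|T|.
rewrite -[\big[_/_]_(_ | _) _]/(distance G x (last x q)) /= => -[dT|].
  (* The default [#|T|] is excluded, since the simple path [q] has fewer edges. *)
  by move: le_q; rewrite dT leqNgt (uniq_size_lt Uq).
case=> l /existsP[p /and3P[Gp /eqP lp _]] ->.
by exists p; rewrite size_tuple.
Qed.

Lemma distance_leq_diam x y : x != y -> distance G x y <= diam G.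
Proof.
move=> xy; apply: leq_trans (leq_bigmax x).
exact: (leq_bigmax_cond (F := distance G x)).
Qed.

Lemma diam_attained : 0 < diam G -> exists x y, x != y /\ distance G x y = diam G.
Proof.
rewrite /diam => /[dup] d0.
have /card_gt0P[x0 _] : 0 < #|T|.
  by case: (posnP #|T|) d0 => // /card0_eq T0; rewrite big_pred0.
have [x ->] : {x | \max_x \max_(y | x != y) distance G x y =
    \max_(y | x != y) distance G x y}.
  by apply: eq_bigmax; apply/card_gt0P; exists x0.
case: (posnP #|[pred y | x != y]|) => [/card0_eq xy|].
  by rewrite big_pred0.
by case/(eq_bigmax_cond (distance G x)) => y xy -> _; exists x, y.
Qed.

Lemma diam_leq m : (forall x y, x != y -> distance G x y <= m) -> diam G <= m.
Proof. by move=> dm; apply/bigmax_leqP => x _; apply/bigmax_leqP => y /dm. Qed.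

Lemma kappa_leq S : separating G S -> kappa G <= #|S|.
Proof. exact: (bigminn_leq (fun S : {set T} => #|S|)). Qed.

(** The bound [m < #|T|] takes care of the default [#|T|.-1] in [kappa]. *)
Lemma leq_kappa m : m < #|T| ->
  (forall S : {set T}, #|S| < m -> connected_in G (~: S)) -> m <= kappa G.
Proof.
move=> mT con; apply: leq_bigminn => [|S]; first by lia.
by apply: contraR; rewrite -ltnNge => /con.
Qed.

Lemma induced_sym (A : {set T}) : symmetric G -> symmetric (induced G A).
Proof. by move=> Gs x y; rewrite /induced /= Gs andbCA. Qed.

Lemma connected_in_center (A : {set T}) r : symmetric G ->
  (forall x, x \in A -> connect (induced G A) r x) -> connected_in G A.
Proof.
move=> Gs con; apply/forall_inP => x Ax; apply/forall_inP => y Ay.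
apply: connect_trans (con _ Ay).
by rewrite (sym_connect_sym (induced_sym _ Gs)) con.
Qed.

(** Each edge of a path raises [h] by at most one, so a path has at least as many edges as [h] rises
    from end to end. *)
Lemma distance_potential (h : T -> nat) x y : connect G x y ->
  (forall u v, G u v -> h v <= (h u).+1) -> h y <= h x + distance G x y.
Proof.
case/distance_path=> p [Gp <- <-] hG.
elim: p x Gp => [x _|z p IHp x /= /andP[/hG hz /IHp]]; rewrite /= ?addn0 //; lia.
Qed.

Lemma free_vertexP i :
  reflect (forall j j', G i j -> G i j' -> j != j' -> G j j') (free_vertex G i).
Proof.
apply: (iffP forallP) => [fi j j' ij ij' jj'|fi j].
  by move/forallP/(_ j')/implyP: (fi j); apply; rewrite ij ij'.
by apply/forallP => j'; apply/implyP => /and3P[]; apply: fi.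
Qed.

Lemma distance_refl x : distance G x x = 0.
Proof. by apply/eqP; rewrite -leqn0 (distance_le_path (p := [::])). Qed.

Lemma distance_triangle x y z : connect G x y -> connect G y z ->
  distance G x z <= distance G x y + distance G y z.
Proof.
case/distance_path=> p [Gp lp <-] /distance_path[q [Gq lq <-]].
rewrite -size_cat -lq -lp -last_cat.
by apply: distance_le_path; rewrite cat_path Gp lp.
Qed.

Lemma distance_le1 x y : (x == y) || G x y -> distance G x y <= 1.
Proof.
case/predU1P=> [->|xy]; first by rewrite distance_refl.
by apply: (distance_le_path (p := [:: y])); rewrite /= xy.
Qed.

Lemma distance_step x u v : connect G x u -> G u v ->
  distance G x v <= (distance G x u).+1.
Proof.
move=> xu uv; apply: leq_trans (distance_triangle xu (connect1 uv)) _.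
by rewrite -addn1 leq_add2l distance_le1 ?uv ?orbT.
Qed.

Lemma distance_leq_sym x y : symmetric G -> connect G x y ->
  distance G y x <= distance G x y.
Proof.
move=> Gs /distance_path[p [Gp <- <-]].
have lx : last (last x p) (rev (belast x p)) = x.
  by case: p {Gp} => //= z p; rewrite rev_cons last_rcons.
rewrite -{2}lx -(size_belast x p) -size_rev distance_le_path // rev_path.
by rewrite (eq_path (e' := G)) // => u v; apply: Gs.
Qed.

Lemma distance1 x y : irreflexive G -> x != y -> connect G x y ->
  (distance G x y == 1) = G x y.
Proof.
move=> Gi xy /distance_path[p [Gp lp dp]]; apply/eqP/idP => [d1|Gxy].
  by move: p Gp lp dp; rewrite d1 => -[|z []] //= /andP[xz _] <-.
apply/eqP; rewrite eqn_leq -{2}dp (distance_le_path (p := [:: y])) /= ?Gxy //.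
by case: p lp {Gp dp} => // xy'; rewrite -xy' /= eqxx in xy.
Qed.

(** A discrete intermediate value theorem. Strictness in [h x < i] places [b] in [p], so that it has
    a predecessor. *)
Lemma path_intermediate (h : T -> nat) i x p : path G x p ->
  (forall u v, G u v -> h v <= (h u).+1) -> h x < i <= h (last x p) ->
  exists p1 b p2, p = p1 ++ b :: p2 /\ h b = i.
Proof.
move=> + hG; elim: p x => [x _ /=|z p IHp x /= /andP[/hG hz Gp] hi]; first by lia.
have [hzi|hzi] := eqVneq (h z) i; first by exists [::], z, p.
have [|p1 [b [p2 [-> hb]]]] := IHp z Gp; first by lia.
by exists (z :: p1), b, p2.
Qed.

End Graph.

(** * Layers of non-free vertices and the necessary conditions *)

Section Layers.
Variables (T : finType) (G : rel T).
Hypotheses (Gs : symmetric G) (Gi : irreflexive G) (Gc : connected_graph G).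

(* A shortest path avoiding the set has no chords, so all its interior vertices
   are non-free, and one of them is at distance [i] from [x]. *)
Lemma layer_separating x y i : 0 < i < distance G x y ->
  separating G [set v | ~~ free_vertex G v && (distance G x v == i)].
Proof.
move=> i_int; set S := [set v | _]; set H := induced G (~: S).
have HG u v : H u v -> G u v by case/and3P.
apply/negP => /forall_inP/(_ x)/[!inE].
case/(_ _)/Wrap; first by rewrite distance_refl; lia.
move/forall_inP/(_ y)/[!inE].
case/(_ _)/Wrap; first by lia.
case/distance_path=> p [Hp lp sp].
have hstep u v : H u v -> distance G x v <= (distance G x u).+1.
  by move/HG; apply: distance_step; apply: connected_graphP.
have [|p1 [b [p2 [def_p db]]]] := path_intermediate (i := i) Hp hstep.
  by rewrite distance_refl lp; lia.
case: p2 def_p => [|c p3] def_p.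
  by move: lp; rewrite def_p last_cat /= => by_; rewrite -by_ db in i_int; lia.
move: Hp lp sp; rewrite def_p cat_path last_cat size_cat /=.
set a := last x p1 => /and4P[Hp1 ab bc Hp3] lp sp.
(* Being on a path in [H], [b] avoids [S]; as its distance from [x] is [i], it can only be free. *)
have fb : free_vertex G b.
  by case/and3P: bc; rewrite !inE db eqxx andbT negbK.
(* The path is shortest in [H]. If the neighbours [a] and [c] of [b] coincide, a detour can be cut
   out; otherwise freeness of [b] gives the chord from [a] to [c]. *)
have [ac|ac] := eqVneq a c.
  have : path H x (p1 ++ p3) by rewrite cat_path Hp1 -/a ac.
  by move/distance_le_path; rewrite last_cat -/a ac lp -sp size_cat; lia.
have Hac : H a c.
  case/and3P: ab => Sa _ ab; case/and3P: bc => _ Sc bc; apply/and3P; split=> //.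
  by apply: (free_vertexP _ _ fb) => //; rewrite Gs.
have : path H x (p1 ++ c :: p3) by rewrite cat_path Hp1 -/a /= Hac.
by move/distance_le_path; rewrite last_cat /= lp -sp size_cat /=; lia.
Qed.

Definition nonfree_within x m :=
  [set v | ~~ free_vertex G v & 0 < distance G x v <= m].

(** Each layer beyond [m0] separates [x] from [y], so it adds at least [kappa G] new vertices. The
    case [m0 = 0] is the full count; [m0 = 1] bounds the layers after the first. *)
Lemma nonfree_within_grow x y m0 m : m0 <= m < distance G x y ->
  #|nonfree_within x m0| + kappa G * (m - m0) <= #|nonfree_within x m|.
Proof.
elim: m => [|m IHm] hm; first by rewrite (_ : m0 = 0) ?muln0 ?addn0; lia.
have [->|m0m] := eqVneq m0 m.+1; first by rewrite subnn muln0 addn0.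
have {}IHm := IHm ltac:(lia).
set S := [set v | ~~ free_vertex G v && (distance G x v == m.+1)].
have kS : kappa G <= #|S| by apply/kappa_leq/(@layer_separating _ y); lia.
rewrite -[leqRHS](cardsID S).
have -> : nonfree_within x m.+1 :&: S = S.
  by apply/setP => v; rewrite !inE; case: free_vertex => //=; lia.
have -> : nonfree_within x m.+1 :\: S = nonfree_within x m.
  by apply/setP => v; rewrite !inE; case: free_vertex => //=; lia.
rewrite subSn; nia.
Qed.

Lemma nonfree_within_count x y : 0 < distance G x y ->
  kappa G * (distance G x y).-1 <= #|nonfree_within x (distance G x y).-1|.
Proof.
by move=> d0; have := @nonfree_within_grow x y 0 (distance G x y).-1 ltac:(lia); lia.
Qed.

Lemma nonfree_within_sub x y m : m < distance G x y ->
  nonfree_within x m \subset ~: [set x; y].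
Proof.
move=> md; apply/subsetP => v; rewrite !inE => /andP[_ hv].
by apply/norP; split; apply: contraTneq hv => ->; rewrite ?distance_refl; lia.
Qed.

(** The layers lie in the complement of [[set x; y]], whose size here is at most their lower
    bound. *)
Lemma nonfree_within_full x y : x != y -> 0 < distance G x y ->
  #|T| <= (kappa G * (distance G x y).-1).+2 ->
  nonfree_within x (distance G x y).-1 = ~: [set x; y].
Proof.
move=> xy d0 hT; apply/eqP; rewrite eqEcard nonfree_within_sub; last by lia.
by have := nonfree_within_count d0; have := cardsC [set x; y]; rewrite cards2 xy; lia.
Qed.

(** There is room for just one vertex per layer. All neighbours of [x] lie in the first layer, so
    [x] has no two distinct neighbours and is vacuously free. *)
Lemma end_free x y : x != y -> 1 < distance G x y -> kappa G = 1 ->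
  #|T| <= (distance G x y).+1 -> free_vertex G x.
Proof.
move=> xy d1 k1 hT; apply/free_vertexP => j j' xj xj' jj'.
have full : nonfree_within x (distance G x y).-1 = ~: [set x; y].
  by apply: nonfree_within_full => //; lia.
have near u : G x u -> u \in nonfree_within x 1.
  move=> xu; have ux : x != u by apply: contraTneq xu => <-; rewrite Gi.
  have du : distance G x u = 1.
    by apply/eqP; rewrite distance1 //; apply: connected_graphP.
  have : u \in ~: [set x; y].
    by rewrite !inE eq_sym (negPf ux) /=; apply: contraTneq d1 => <-; rewrite du.
  by rewrite -full !inE du => /andP[->].
have : [set j; j'] \subset nonfree_within x 1.
  by apply/subsetP => u; rewrite in_set2 => /orP[] /eqP ->; apply: near.
move/subset_leq_card; rewrite cards2 jj'.
have := @nonfree_within_grow x y 1 (distance G x y).-1 ltac:(lia).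
by have := cardsC [set x; y]; rewrite full cards2 xy k1; lia.
Qed.

(** The single layer between [x] and [y] has to contain all other vertices. *)
Lemma adjacent_ends x y v : distance G x y = 2 -> x != y ->
  #|T| <= (kappa G).+2 -> v != x -> v != y -> G x v /\ ~~ free_vertex G v.
Proof.
move=> d2 xy hT vx vy.
have : v \in ~: [set x; y] by rewrite !inE negb_or vx.
rewrite -(@nonfree_within_full x y) ?d2 //; last by lia.
rewrite !inE => /andP[-> hv]; split=> //.
by rewrite -distance1 1?eq_sym //; [apply/eqP; lia | apply: connected_graphP].
Qed.

Lemma num_freeC : num_free G + #|[set v | ~~ free_vertex G v]| = #|T|.
Proof.
rewrite -(cardsC [set v | free_vertex G v]); congr (_ + _).
by apply: eq_card => v; rewrite !inE.
Qed.

Lemma two_free x y : x != y -> free_vertex G x -> free_vertex G y ->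
  2 <= num_free G.
Proof.
move=> xy fx fy; have <- : #|[set x; y]| = 2 by rewrite cards2 xy.
by apply/subset_leq_card/subsetP => v; rewrite !inE => /orP[] /eqP ->.
Qed.

Lemma free_diam_kappa_bounds : 2 <= diam G -> 1 <= kappa G ->
  num_free G + diam G + kappa G = #|T| + 1 ->
  2 <= num_free G /\ (kappa G).-1 * (diam G - 2) <= 1.
Proof.
move=> d2 k1 sum.
have [|x [y [xy dxy]]] := @diam_attained _ G; first by lia.
have yx : y != x by rewrite eq_sym.
have dyx : distance G y x = diam G.
  apply/eqP; rewrite -dxy eqn_leq !distance_leq_sym //; exact: connected_graphP.
have := @nonfree_within_count x y; rewrite dxy => /(_ ltac:(lia)) cnt.
have : #|nonfree_within x (diam G).-1| <= #|[set v | ~~ free_vertex G v]|.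
  by apply/subset_leq_card/subsetP => v; rewrite !inE => /andP[].
have := num_freeC => nf leN.
have : #|nonfree_within x (diam G).-1| <= #|T| - 2.
  have := cardsC [set x; y]; rewrite cards2 xy => <-.
  by rewrite addKn; apply/subset_leq_card/nonfree_within_sub; lia.
(* With [k = kappa G] and [d = diam G], [k (d - 1) <= d + k - 1] rearranges to
   [(k - 1) (d - 2) <= 1]. *)
move=> leT; split; last by nia.
(* The bound [k (d - 1) <= #|T| - 2] amounts to [(k - 1) (d - 2) <= f - 1] over the integers, where
   [f = num_free G]. So [f] is positive, and [f = 1] forces [k = 1] or [d = 2]. *)
have [//|f_eq1] : 2 <= num_free G \/ num_free G = 1 by nia.
have [kd|/eqP kd] : kappa G = 1 \/ diam G == 2 by nia.
  by apply: (two_free xy); [apply: (@end_free x y)|apply: (@end_free y x)] => //; lia.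
have adj u v : distance G u v = diam G -> u != v ->
    forall w, w != u -> w != v -> G u w /\ ~~ free_vertex G w.
  by move=> duv uv w wu wv; apply: (@adjacent_ends u v) => //; lia.
(* Both ends are adjacent to all other vertices but not to each other. Thus if one end is free, the
   other vertices form a clique, and the second end is free too. *)
have clique u v : distance G u v = diam G -> u != v ->
    free_vertex G u -> free_vertex G v.
  move=> duv uv fu.
  have nuv : ~~ G v u.
    rewrite Gs -distance1 ?duv ?kd //; exact: connected_graphP.
  apply/free_vertexP => j j' vj vj' jj'.
  have neq z : G v z -> z != u /\ z != v.
    by move=> vz; split; apply: contraTneq vz => ->; rewrite ?Gi ?nuv.
  have [ju jv] := neq _ vj; have [j'u j'v] := neq _ vj'.
  have [uj _] := adj _ _ duv uv _ ju jv; have [uj' _] := adj _ _ duv uv _ j'u j'v.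
  exact: (free_vertexP _ _ fu).
(* The only free vertex must be an end, since the others are non-free; then the opposite end is a
   second one. *)
have /card_gt0P[v] : 0 < num_free G by rewrite f_eq1.
rewrite inE => fv.
have [vx|vx] := eqVneq v x.
  by rewrite vx in fv; apply: (two_free xy fv); apply: (clique x y).
have [vy|vy] := eqVneq v y.
  by rewrite vy in fv; apply: (two_free xy _ fv); apply: (clique y x).
by have [_ /negP] := adj _ _ dxy xy _ vx vy.
Qed.

End Layers.

(** * Sufficient criteria for diameter and connectivity *)

Section Certificate.
Variables (T : finType) (G : rel T).

Lemma connected_graphI : (forall x y, connect G x y) -> connected_graph G.
Proof.
move=> con; apply/forall_inP => x _; apply/forall_inP => y _.
rewrite -(eq_connect (e := G)) // => u v.
by rewrite /induced /= !inE.
Qed.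

Lemma separating_isolated (S : {set T}) x y : x \notin S -> y \notin S ->
  x != y -> (forall v, G x v -> v \in S) -> separating G S.
Proof.
move=> xS yS xy iso; apply/negP => /forall_inP/(_ x)/[!inE]/(_ xS).
move/forall_inP/(_ y)/[!inE]/(_ yS)/connectP=> [[|v p] /=].
  by move=> _ exy; rewrite exy eqxx in xy.
by case/andP=> /and3P[_ + /iso vS]; rewrite inE vS.
Qed.

(* [h], being 1-Lipschitz, bounds the diameter from below. *)
Lemma graph_certificate (h : T -> nat) d k x0 y0 (S0 : {set T}) :
  symmetric G -> irreflexive G -> 2 <= d -> 0 < k < #|T| ->
  (forall S : {set T}, #|S| < k -> connected_in G (~: S)) ->
  separating G S0 -> #|S0| = k ->
  (forall u v, G u v -> h v <= (h u).+1) -> h x0 = 0 -> h y0 = d ->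
  (connected_graph G -> forall x y, distance G x y <= d) ->
  [/\ simple_graph G, ~~ complete_graph G, connected_graph G,
      diam G = d & kappa G = k].
Proof.
move=> Gs Gi d2 /andP[k0 kT] con sepS cardS hG hx hy dle.
(* This is the deletion of the empty set, which has fewer than [k] elements. *)
have Gc : connected_graph G.
  by rewrite /connected_graph -setC0; apply: con; rewrite cards0.
have dxy : d <= distance G x0 y0.
  rewrite -hy -[leqRHS]add0n -hx; apply: distance_potential hG.
  exact: connected_graphP.
have xy : x0 != y0 by apply: contraTneq dxy => ->; rewrite distance_refl; lia.
have nGxy : ~~ G x0 y0 by apply: contraTN dxy => /hG; lia.
split=> //.
- by apply/negP => /forallP/(_ x0)/forallP/(_ y0)/implyP/(_ xy); apply/negP.
- apply/eqP; rewrite eqn_leq (leq_trans dxy) ?distance_leq_diam // andbT.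
  by apply: diam_leq => x y _; apply: dle.
- apply/eqP; rewrite eqn_leq -{1}cardS kappa_leq //=.
  exact: leq_kappa.
Qed.

End Certificate.

(** * Graphs on ['I_n] and the three families of examples *)

Lemma card_ord_geq n c : #|[set i : 'I_n | c <= i]| = n - c.
Proof.
rewrite -sum1dep_card -(big_geq_mkord _ _ xpredT (fun=> 1)).
by rewrite sum_nat_const_nat muln1.
Qed.

Lemma card_ord_lt n c : c <= n -> #|[set i : 'I_n | i < c]| = c.
Proof.
move=> cn; have := cardsC [set i : 'I_n | c <= i].
rewrite card_ord_geq card_ord (_ : ~: _ = [set i : 'I_n | i < c]); first by lia.
by apply/setP => i; rewrite !inE -ltnNge.
Qed.

Lemma num_free_ord n (G : rel 'I_n) c :
  (forall i : 'I_n, free_vertex G i = (c <= i)) -> num_free G = n - c.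
Proof.
by move=> fG; rewrite -card_ord_geq; apply: eq_card => i; rewrite !inE fG.
Qed.

Lemma not_free (T : finType) (G : rel T) i j j' : G i j -> G i j' -> j != j' ->
  ~~ G j j' -> free_vertex G i = false.
Proof.
by move=> ij ij' jj'; apply: contraNF => /free_vertexP; apply.
Qed.

(** Only the values of [a] on increasing pairs matter, so any [a] yields a simple graph. *)
Definition ordered_graph n (a : rel nat) : rel 'I_n :=
  fun i j => (i < j) && a i j || (j < i) && a j i.

Section OrderedGraph.
Variables (n : nat) (a : rel nat).

Lemma ordered_graph_sym : symmetric (@ordered_graph n a).
Proof. by move=> i j; rewrite /ordered_graph orbC. Qed.

Lemma ordered_graph_irr : irreflexive (@ordered_graph n a).
Proof. by move=> i; rewrite /ordered_graph ltnn. Qed.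

End OrderedGraph.

(* The join of a clique on [i < k.-1] with the double star with centers [k.-1]
   and [k]; the only leaf at [k.-1] is [k.+1]. *)
Section DiameterTwo.
Variables (n k : nat).
Hypotheses (k2 : 2 <= k) (kn : k.+2 < n).

Let G := @ordered_graph n (fun i j => [|| i < k.-1,
  (i == k.-1) && (j <= k.+1) | (i == k) && (k.+2 <= j)]).

Lemma diam2_free i : free_vertex G i = (k < i).
Proof.
case: (ltnP k i) => ki.
  (* [c] is the center carrying the leaf [i]; together with the clique it contains all neighbours of
     [i]. *)
  pose c := if i == k.+1 :> nat then k.-1 else k.
  have nbr j : G i j -> (j < k.-1) || (j == c :> nat).
    by rewrite /c /G /ordered_graph; case: ifP => ik; lia.
  apply/free_vertexP => j j' /nbr + /nbr; rewrite -val_eqE /G /ordered_graph /=.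
  by have [jk|jk] := ltnP j k.-1; have [j'k|j'k] := ltnP j' k.-1; lia.
have n0 : k.-1 < n by lia.
have n1 : k < n by lia.
have n2 : k.+1 < n by lia.
have [ik|ik] := ltnP i k.-1.
  by apply: (@not_free _ _ _ (Ordinal n2) (Ordinal kn));
    rewrite /G /ordered_graph -?val_eqE /=; lia.
have [ik1|ik1] := eqVneq (i : nat) k.
  by apply: (@not_free _ _ _ (Ordinal n0) (Ordinal kn));
    rewrite /G /ordered_graph -?val_eqE /=; lia.
by apply: (@not_free _ _ _ (Ordinal n1) (Ordinal n2));
  rewrite /G /ordered_graph -?val_eqE /=; lia.
Qed.

(** A surviving vertex below [k.-1] is adjacent to everything. If none survives, [S] is by
    cardinality exactly that clique, and the connected double star remains. *)
Lemma diam2_connected (S : {set 'I_n}) : #|S| < k -> connected_in G (~: S).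
Proof.
move=> Sk; have [/existsP[u /andP[uk uS]]|nu] :=
  boolP [exists u : 'I_n, (u < k.-1) && (u \notin S)].
  apply: (connected_in_center (r := u)) => [|x xS]; first exact: ordered_graph_sym.
  have [->//|ux] := eqVneq u x.
  apply: connect1; rewrite /induced /= inE uS xS /G /ordered_graph.
  by move: ux; rewrite -val_eqE /=; lia.
have n0 : k.-1 < n by lia.
have n1 : k < n by lia.
have SE : S = [set i : 'I_n | i < k.-1].
  apply/esym/eqP; rewrite eqEcard card_ord_lt; last by lia.
  apply/andP; split; last by lia.
  apply/subsetP => u; rewrite inE => uk; apply: contraNT nu => uS.
  by apply/existsP; exists u; rewrite uk.
apply: (connected_in_center (r := Ordinal n0)) => [|x]; first exact: ordered_graph_sym.
rewrite SE !inE => xk.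
have [<-//|xk1] := eqVneq x (Ordinal n0).
move: xk1; rewrite -val_eqE /= => xk1.
have [xk2|xk2] := leqP x k.+1.
  apply: connect1; rewrite /induced /= !inE /G /ordered_graph /=; lia.
apply: (connect_trans (y := Ordinal n1)); apply: connect1;
  rewrite /induced /= !inE /G /ordered_graph /=; lia.
Qed.

Lemma diam2_graph : exists G : rel 'I_n,
  [/\ simple_graph G, ~~ complete_graph G, connected_graph G
    & (num_free G, diam G, kappa G) = (n - k.+1, 2, k)].
Proof.
exists G.
have n0 : 0 < n by lia.
have n2 : k.+1 < n by lia.
(* The leaf [k.+1] is at distance 2 from the leaf [k.+2], and its neighbourhood [[set i | i < k]]
   cuts it off. *)
have [|||||||||||? ? ? -> ->] := 
  @graph_certificate _ G (fun i : 'I_n =>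
    if i == k.+1 :> nat then 0 else if i < k then 1 else 2)
  2 k (Ordinal n2) (Ordinal kn) [set i : 'I_n | i < k].
- exact: ordered_graph_sym.
- exact: ordered_graph_irr.
- by [].
- by rewrite card_ord; lia.
- exact: diam2_connected.
- apply: (@separating_isolated _ _ _ (Ordinal n2) (Ordinal kn));
    rewrite ?inE -?val_eqE /=; try lia.
  move=> v; rewrite inE /G /ordered_graph /=; lia.
- by rewrite card_ord_lt //; lia.
- by move=> u v; rewrite /G /ordered_graph; do !case: ifP => ?; lia.
- by rewrite /= eqxx.
- by rewrite /=; do !case: ifP; lia.
- move=> Gc x y.
  (* As [2 <= k], vertex 0 belongs to the clique and is adjacent to every other vertex. *)
  pose c := Ordinal n0; apply: leq_trans (distance_triangle (y := c) _ _) _;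
    try exact: connected_graphP.
  by apply: (@leq_add _ _ 1 1); apply: distance_le1;
    rewrite /G /ordered_graph -val_eqE /=; lia.
by split=> //; rewrite (@num_free_ord _ _ k.+1) // => i; rewrite diam2_free.
Qed.

End DiameterTwo.

(* The spine is [1 - 2 - ... - d]; all vertices [> d] hang at [1], and [0] is a
   twin of [1] on the vertices [1], [2], [d.+1]. *)
Section KappaOne.
Variables (n d : nat).
Hypotheses (d2 : 2 <= d) (dn : d.+1 < n) (n5 : 4 < n).

Let G := @ordered_graph n (fun i j => [|| (i == 0) && (j \in [:: 1; 2; d.+1]),
  (0 < i) && (j == i.+1) && (j <= d) | (i == 1) && (d < j)]).

Lemma kappa1_free i : free_vertex G i = (d <= i).
Proof.
have n2 : 2 < n by lia.
case: (leqP d i) => di.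
  (* For [2 < d] the end [d] of the spine has the single neighbour [d.-1]; the other vertices from
     [d] on see at most the adjacent twins 0 and 1. *)
  have nbr j : G i j ->
      if (2 < d) && (i == d :> nat) then j == d.-1 :> nat else j < 2.
    by rewrite /G /ordered_graph !inE; case: ifP => i_d; lia.
  apply/free_vertexP => j j' /nbr + /nbr; rewrite -val_eqE /G /ordered_graph /= !inE.
  by case: ifP => _; lia.
have [i1|i1] := leqP i 1.
  by apply: (@not_free _ _ _ (Ordinal dn) (Ordinal n2));
    rewrite /G /ordered_graph -?val_eqE /= ?inE; lia.
have m1 : i.-1 < n by lia.
have m2 : i.+1 < n by lia.
by apply: (@not_free _ _ _ (Ordinal m1) (Ordinal m2));
  rewrite /G /ordered_graph -?val_eqE /= ?inE; lia.
Qed.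

Lemma kappa1_spine (i j : 'I_n) : 0 < i <= j -> j <= d ->
  exists p, [/\ path G i p, last i p = j & size p = j - i].
Proof.
move=> + jd; have [m] := ubnP (j - i); elim: m i => // m IHm i le_m ij.
have [eij|neij] := eqVneq i j; first by exists [::]; rewrite eij subnn.
have ni : i.+1 < n by move: neij; rewrite -val_eqE /=; have := ltn_ord j; lia.
have [||p [Gp lp sp]] := IHm (Ordinal ni).
- by move: neij; rewrite -val_eqE /=; lia.
- by move: neij; rewrite -val_eqE /=; lia.
exists (Ordinal ni :: p); split=> //=; last by move: sp neij; rewrite -val_eqE /=; lia.
rewrite Gp andbT /G /ordered_graph /= !inE; move: neij; rewrite -val_eqE /=; lia.
Qed.

Lemma kappa1_connected (S : {set 'I_n}) : #|S| < 1 -> connected_in G (~: S).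
Proof.
rewrite ltnS leqn0 cards_eq0 => /eqP ->; rewrite setC0.
have n1 : 1 < n by lia.
suff con x : connect G (Ordinal n1) x.
  apply: connected_graphI => x y; apply: connect_trans (con y).
  by rewrite (sym_connect_sym (@ordered_graph_sym _ _)).
have [x1|x1] := boolP (0 < x <= d).
  have [||p [Gp lp _]] := @kappa1_spine (Ordinal n1) x; rewrite /=; try lia.
  by apply/connectP; exists p.
by apply: connect1; rewrite /G /ordered_graph /= !inE; lia.
Qed.

(** Vertices off the spine are adjacent to 1, so they reach a spine vertex [y] in at most [y] steps
    and each other in at most two. Symmetry reduces the rest to walking up the spine. *)
Lemma kappa1_distance : connected_graph G -> forall x y, distance G x y <= d.
Proof.
move=> Gc; have n1 : 1 < n by lia.
have Gsym : symmetric G by apply: ordered_graph_sym.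
pose c := Ordinal n1; pose spine (x : 'I_n) := 0 < x <= d.
have cG x : ~~ spine x -> G x c.
  by rewrite /spine /G /ordered_graph /= !inE; lia.
have key x y : spine y -> (spine x -> x <= y) -> distance G x y <= d.
  rewrite /spine => y_d xy; have [x_d|/cG xc] := boolP (spine x).
    have [||p [Gp lp sp]] := @kappa1_spine x y; rewrite /spine in x_d; try lia.
    by rewrite -lp; apply: leq_trans (distance_le_path Gp) _; rewrite sp; lia.
  have [||p [Gp lp sp]] := @kappa1_spine c y; rewrite /=; try lia.
  have Gcp : path G x (c :: p) by rewrite /= xc.
  rewrite -lp; apply: leq_trans (distance_le_path Gcp) _; rewrite /= sp /=; lia.
have distC x y : distance G x y <= d -> distance G y x <= d.
  apply: leq_trans; apply: distance_leq_sym Gsym _.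
  exact: connected_graphP.
move=> x y; have [y_d|y_d] := boolP (spine y).
  have [xy|/ltnW yx] := leqP x y; first exact: key.
  have [x_d|x_d] := boolP (spine x); first exact/distC/key.
  by apply: key => //; rewrite (negPf x_d).
have [x_d|x_d] := boolP (spine x).
  by apply/distC/key => //; rewrite (negPf y_d).
apply: leq_trans (distance_triangle (y := c) _ _) _; try exact: connected_graphP.
apply: leq_trans d2; apply: (@leq_add _ _ 1 1); apply: distance_le1.
  by rewrite cG ?orbT.
by rewrite (Gsym c) cG ?orbT.
Qed.

Lemma kappa1_graph : exists G : rel 'I_n,
  [/\ simple_graph G, ~~ complete_graph G, connected_graph G
    & (num_free G, diam G, kappa G) = (n - d, d, 1)].
Proof.
exists G.
have n0 : 0 < n by lia.
have nd : d < n by lia.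
have n1 : 1 < n by lia.
have [S sepS cardS] : exists2 S, separating G S & #|S| = 1.
  (* If vertex [d.+2] exists, its only neighbour is 1. Otherwise [n = d.+2], so [4 < n] gives
     [3 <= d], and the spine end [d] hangs at [d.-1] alone. *)
  have [nd2|nd2] := ltnP d.+2 n.
    exists [set Ordinal n1]; last by rewrite cards1.
    apply: (@separating_isolated _ _ _ (Ordinal nd2) (Ordinal n0));
    rewrite ?inE -?val_eqE //=.
    by move=> v; rewrite inE -val_eqE /G /ordered_graph /= !inE; lia.
  have nd1 : d.-1 < n by lia.
  exists [set Ordinal nd1]; last by rewrite cards1.
  apply: (@separating_isolated _ _ _ (Ordinal nd) (Ordinal n0));
    rewrite ?inE -?val_eqE //=; try lia.
  by move=> v; rewrite inE -val_eqE /G /ordered_graph /= !inE; lia.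
(* The potential counts steps along the spine from the leaf [d.+1]; vertex 0 gets the value of its
   twin 1. *)
have [|||||||||||? ? ? -> ->] := 
  @graph_certificate _ G (fun i : 'I_n =>
    if i == 0 :> nat then 1 else if i <= d then i : nat else 0)
  d 1 (Ordinal dn) (Ordinal nd) S.
- exact: ordered_graph_sym.
- exact: ordered_graph_irr.
- by [].
- by rewrite card_ord; lia.
- exact: kappa1_connected.
- by [].
- by [].
- by move=> u v; rewrite /G /ordered_graph !inE; do !case: ifP => ?; lia.
- by rewrite /= ltnn.
- by rewrite /=; do !case: ifP; lia.
- exact: kappa1_distance.
by split=> //; rewrite (@num_free_ord _ _ d) // => i; rewrite kappa1_free.
Qed.

End KappaOne.

(* A clique on [0], [1], [2], [3], a vertex [4] adjacent to [2] and [3], and all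
   other vertices adjacent to [0] and [1]. *)
Section KappaTwo.
Variable n : nat.
Hypothesis n5 : 5 < n.

Let G := @ordered_graph n (fun i j =>
  [|| j < 4, (1 < i) && (j == 4) && (i < 4) | (i < 2) && (4 < j)]).

Lemma kappa2_free i : free_vertex G i = (4 <= i).
Proof.
have n0 : 0 < n by lia.
have n2 : 2 < n by lia.
have n4 : 4 < n by lia.
case: (leqP 4 i) => i4.
  apply/free_vertexP => j j'; rewrite /G /ordered_graph -val_eqE /=; lia.
have [i1|i1] := leqP i 1.
  by apply: (@not_free _ _ _ (Ordinal n5) (Ordinal n2));
    rewrite /G /ordered_graph -?val_eqE /=; lia.
by apply: (@not_free _ _ _ (Ordinal n4) (Ordinal n0));
  rewrite /G /ordered_graph -?val_eqE /=; lia.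
Qed.

(** One of 0, 1 and one of 2, 3 survive. The first is adjacent to every other vertex but 4, which is
    reached through the second. *)
Lemma kappa2_connected (S : {set 'I_n}) : #|S| < 2 -> connected_in G (~: S).
Proof.
move=> S2.
have avoid m (m0 : m < n) (m1 : m.+1 < n) :
    exists2 u : 'I_n, m <= u <= m.+1 & u \notin S.
  have [m0S|] := boolP (Ordinal m0 \in S); last by exists (Ordinal m0) => //=; lia.
  have [m1S|] := boolP (Ordinal m1 \in S); last by exists (Ordinal m1) => //=; lia.
  have : [set Ordinal m0; Ordinal m1] \subset S.
    by apply/subsetP => u; rewrite !inE => /orP[] /eqP ->.
  by move/subset_leq_card; rewrite cards2 -val_eqE /= neq_ltn ltnSn leqNgt S2.
have [u u01 uS] := @avoid 0 ltac:(lia) ltac:(lia).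
have [v v23 vS] := @avoid 2 ltac:(lia) ltac:(lia).
apply: (connected_in_center (r := u)) => [|x xS]; first exact: ordered_graph_sym.
have [->//|ux] := eqVneq u x.
have adj (y z : 'I_n) : y \notin S -> z \notin S -> G y z ->
    connect (induced G (~: S)) y z.
  by move=> yS zS yz; apply: connect1; rewrite /induced /= !inE yS zS.
move: ux xS; rewrite -val_eqE inE /= => ux xS.
have [x4|x4] := eqVneq (x : nat) 4.
  by apply: (connect_trans (y := v)); apply: adj => //; rewrite /G /ordered_graph; lia.
by apply: adj => //; rewrite /G /ordered_graph; lia.
Qed.

Lemma kappa2_graph : exists G : rel 'I_n,
  [/\ simple_graph G, ~~ complete_graph G, connected_graph G
    & (num_free G, diam G, kappa G) = (n - 4, 3, 2)].
Proof.
exists G.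
have n0 : 0 < n by lia.
have n2 : 2 < n by lia.
have n3 : 3 < n by lia.
have n4 : 4 < n by lia.
have [|||||||||||? ? ? -> ->] := 
  @graph_certificate _ G (fun i : 'I_n =>
    if i < 2 then 1 else if i < 4 then 2 else if i == 4 :> nat then 3 else 0)
  3 2 (Ordinal n5) (Ordinal n4) [set Ordinal n2; Ordinal n3].
- exact: ordered_graph_sym.
- exact: ordered_graph_irr.
- by [].
- by rewrite card_ord; lia.
- exact: kappa2_connected.
- apply: (@separating_isolated _ _ _ (Ordinal n4) (Ordinal n0));
    rewrite ?inE -?val_eqE //=.
  by move=> v; rewrite !inE -!val_eqE /G /ordered_graph /=; lia.
- by rewrite cards2 -val_eqE.
- by move=> u v; rewrite /G /ordered_graph; do !case: ifP => ?; lia.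
- by [].
- by [].
- move=> Gc x y.
  (* [c z] is a vertex of the 4-clique equal or adjacent to [z], so [x], [c x], [c y], [y] is a
     route of at most three edges. *)
  pose c (z : 'I_n) := if z == 4 :> nat then Ordinal n2 else Ordinal n0.
  have dc z : ((z == c z) || G z (c z)) && ((c z == z) || G (c z) z).
    rewrite /c; case: ifP => hz; rewrite /G /ordered_graph -!val_eqE /=; lia.
  apply: leq_trans (distance_triangle (y := c x) _ _) _; try exact: connected_graphP.
  apply: (@leq_add _ _ 1 2); first by apply: distance_le1; case/andP: (dc x).
  apply: leq_trans (distance_triangle (y := c y) _ _) _; try exact: connected_graphP.
  apply: (@leq_add _ _ 1 1); last by apply: distance_le1; case/andP: (dc y).
  apply: distance_le1.
  by rewrite /c; do 2 case: ifP => _; rewrite /G /ordered_graph -val_eqE /=; lia.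
by split=> //; rewrite (@num_free_ord _ _ 4) // => i; rewrite kappa2_free.
Qed.

End KappaTwo.

(** * The classification, from the bounds and the examples *)

Theorem corollary3p5 (n f d k : nat) (hn : 8 <= n) (hf : 0 <= f)
    (hd : 2 <= d) (hk : 1 <= k) :
  (exists G : rel 'I_n,
      [/\ simple_graph G, ~~ complete_graph G, connected_graph G,
          num_free G + diam G + kappa G = n + 1
        & (num_free G, diam G, kappa G) = (f, d, k)])
  <->
  (f + d + k = n + 1 /\
   [\/ [/\ 2 <= f, 1 <= k & d = 2],
       [/\ 2 <= f, k = 1 & 2 <= d]
     | [/\ 2 <= f, k = 2 & d = 3]]).
Proof.
split=> [[G [[Gs Gi] _ Gc sum [Ef Ed Ek]]]|[sum cases]].
  have [|||f2 bound] := free_diam_kappa_bounds Gs Gi Gc.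
  - by rewrite Ed.
  - by rewrite Ek.
  - by rewrite card_ord.
  rewrite Ef Ed Ek in sum f2 bound; split=> //.
  have [dE|k1|kd] : [\/ d = 2, k = 1 | k = 2 /\ d = 3].
    have [d2|d2] := eqVneq d 2; first by constructor 1.
    have [k1|k1] := eqVneq k 1; first by constructor 2.
    (* Both factors of [k.-1 * (d - 2) <= 1] are now positive, hence equal to 1. *)
    by constructor 3; nia.
  - by constructor 1.
  - by constructor 2.
  - by constructor 3; case: kd.
suff [G [Gsimple Gnc Gc E]] : exists G : rel 'I_n,
    [/\ simple_graph G, ~~ complete_graph G, connected_graph G
      & (num_free G, diam G, kappa G) = (f, d, k)].
  by exists G; case: (E) => -> -> ->; split.
have f2 : 2 <= f by case: cases => -[].
(* [k = 1] is settled first, including [d = 2], because the diameter-two family requires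
   [2 <= k]. *)
have [k1|k1] := eqVneq k 1.
  have -> : f = n - d by lia.
  by rewrite k1; apply: kappa1_graph; lia.
case: cases => [[_ _ dE]|[_ /eqP]|[_ kE dE]]; last 2 first.
- by rewrite (negPf k1).
- have -> : f = n - 4 by lia.
  by rewrite kE dE; apply: kappa2_graph; lia.
have -> : f = n - k.+1 by lia.
by rewrite dE; apply: diam2_graph; lia.
Qed.
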